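(* Let $(M,g)$ be a Riemannian $4$-manifold with $\mathrm{Rm}\in\mathfrak{C}_{\eta,\mu}$ for some $\eta\in[0,\frac{9}{16})$ and $\mu\ge\eta+1$ with $\mu>1$. Then $(M,g)$ is Ricci pinched in the following sense: $$\mathrm{Ric}\ge\Bigl(1-\frac43\sqrt{\eta}\Bigr)\frac{\mathcal{R}}{4}\,g\ge0.$$
   Context: All manifolds are smooth and connected (possibly non-orientable) and Riemannian metrics are smooth. $\mathcal{R}$ is the scalar curvature. Curvature operator. At a point $p$ of a Riemannian $4$-manifold, $\wedge^2T_pM$ carries the inner product for which $\{e_i\wedge e_j\}_{i<j}$ is orthonormal whenever $\{e_i\}$ is an orthonormal basis. The curvature operator $\mathrm{Rm}$ is the self-adjoint operator on $\wedge^2T_pM$ given by $\langle \mathrm{Rm}(X\wedge Y),Z\wedge W\rangle=R(X,Y,Z,W)$, with the sign convention that $R(e_1,e_2,e_1,e_2)$ is the sectional curvature of the plane spanned by $e_1,e_2$. The cone $\mathfrak{C}_{\eta,\mu}$. Choose an orientation of $T_pM$ and split $\wedge^2T_pM=\wedge^+\oplus\wedge^-$ into the $\pm1$-eigenspaces of the Hodge star. Write $\mathrm{Rm}=\begin{pmatrix}A & B \\ B^T & C\end{pmatrix}$ with $A:\wedge^+\to\wedge^+$, $C:\wedge^-\to\wedge^-$, $B:\wedge^-\to\wedge^+$. Let $A_1\le A_2\le A_3$ and $C_1\le C_2\le C_3$ be the eigenvalues of $A$ and $C$, and $0\le B_1\le B_2\le B_3$ the singular values of $B$. For constants $\mu-1\ge\eta\ge0$,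 $\mu>1$, $\mathfrak{C}_{\eta,\mu}$ is the set of algebraic curvature operators (symmetric and satisfying the first Bianchi identity) with $$(B_2+B_3)^2\le\eta(A_1+A_2)(C_1+C_2),\quad A_2+A_3\le\mu(A_1+A_2),\quad C_2+C_3\le\mu(C_1+C_2).$$ This is independent of the choice of orientation. ''$\mathrm{Rm}\in\mathfrak{C}_{\eta,\mu}$'' means this holds at every point of $M$. *)

(* Defs.v *)
From HB Require Import structures.
From mathcomp Require Import all_boot all_order all_algebra.
From mathcomp Require Import all_classical all_reals all_analysis.
From mathcomp Require Import ring.

Set Implicit Arguments.
Unset Strict Implicit.
Unset Printing Implicit Defensive.

Import Order.TTheory GRing.Theory Num.Theory.
Import numFieldNormedType.Exports.
Local Open Scope classical_set_scope.
Local Open Scope ring_scope.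

Section Smooth.
Context {R : realType} {n : nat}.
Implicit Types (f : 'rV[R]_n -> R) (U : set 'rV[R]_n).

Definition partial (i : 'I_n) f (x : 'rV[R]_n) : R :=
  'D_(delta_mx 0 i : 'rV[R]_n) f x.

(* [class_C k U f] is meant for open [U]. *)
Fixpoint class_C (k : nat) U f : Prop :=
  (forall x, U x -> {for x, continuous f}) /\
  if k is k'.+1 then
    forall i : 'I_n,
      (forall x, U x -> derivable f x (delta_mx 0 i : 'rV[R]_n)) /\
      class_C k' U (partial i f)
  else True.

Definition smooth_on U f := forall k, class_C k U f.

End Smooth.

(* Only the restrictions of [chart_map] to [chart_dom] and of [chart_inv] to the
   image of [chart_map] are meaningful; both are total functions. *)
Record chart (R : realType) (n : nat) (M : topologicalType) := Chart {
  chart_dom : set M;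
  chart_map : M -> 'rV[R]_n;
  chart_inv : 'rV[R]_n -> M;
  chart_dom_open : open chart_dom;
  chart_img_open : open (chart_map @` chart_dom);
  chart_mapK : forall p, chart_dom p -> chart_inv (chart_map p) = p;
  chart_map_cont : forall p, chart_dom p -> {for p, continuous chart_map};
  chart_inv_cont :
    forall x, (chart_map @` chart_dom) x -> {for x, continuous chart_inv}
}.

Definition transition (R : realType) n (M : topologicalType)
    (c c' : chart R n M) : 'rV[R]_n -> 'rV[R]_n :=
  chart_map c' \o chart_inv c.

Definition overlap (R : realType) n (M : topologicalType)
    (c c' : chart R n M) : set 'rV[R]_n :=
  chart_map c @` (chart_dom c `&` chart_dom c').

Record smooth_manifold (R : realType) (n : nat) := SmoothManifold {
  manifold_space :> topologicalType;
  manifold_hausdorff : hausdorff_space manifold_space;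
  manifold_second_countable : @second_countable manifold_space;
  manifold_connected : connected [set: manifold_space];
  atlas_index : Type;
  atlas : atlas_index -> chart R n manifold_space;
  atlas_cover : forall p, exists i, chart_dom (atlas i) p;
  atlas_smooth : forall i j (k : 'I_n),
    smooth_on (overlap (atlas i) (atlas j))
      (fun x => transition (atlas i) (atlas j) x 0 k)
}.

(* A tangent vector at a point of the domain of [atlas i] is given by its row
   vector of components [X] in that chart; its components in [atlas j] are
   [X *m 'J (transition (atlas i) (atlas j)) x]. A metric is given by its Gram
   matrices in the charts. *)
Record riemannian_metric (R : realType) (n : nat) (M : smooth_manifold R n) :=
  RiemannianMetric {
  gram :> atlas_index M -> 'rV[R]_n -> 'M[R]_n;
  gram_smooth : forall i (k l : 'I_n),
    smooth_on (chart_map (atlas i) @` chart_dom (atlas i))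
      (fun x => gram i x k l);
  gram_sym : forall i p, chart_dom (atlas i) p ->
    (gram i (chart_map (atlas i) p))^T = gram i (chart_map (atlas i) p);
  gram_pos : forall i p, chart_dom (atlas i) p ->
    forall X : 'rV[R]_n, X != 0 ->
    0 < (X *m gram i (chart_map (atlas i) p) *m X^T) 0 0;
  gram_compat : forall i j x, overlap (atlas i) (atlas j) x ->
    gram i x = 'J (transition (atlas i) (atlas j)) x
               *m gram j (transition (atlas i) (atlas j) x)
               *m ('J (transition (atlas i) (atlas j)) x)^T
}.

Section Curvature.
Context {R : realType} {n : nat}.
Variables (G : 'rV[R]_n -> 'M[R]_n) (x : 'rV[R]_n).
Implicit Types (i j k l m : 'I_n) (X Y Z W : 'rV[R]_n).

Definition metric_at X Y : R := (X *m G x *m Y^T) 0 0.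

(* Gamma^k_ij *)
Definition christoffel k i j (y : 'rV[R]_n) : R :=
  2^-1 * \sum_l invmx (G y) k l *
    (partial i (fun z => G z j l) y + partial j (fun z => G z i l) y
     - partial l (fun z => G z i j) y).

(* the [l]-th component of [R(d_i, d_j) d_k], where
   [R(X, Y) Z = D_X D_Y Z - D_Y D_X Z - D_[X, Y] Z] *)
Definition riemann_comp l i j k : R :=
  partial i (christoffel l j k) x - partial j (christoffel l i k) x
  + \sum_m (christoffel l i m x * christoffel m j k x
            - christoffel l j m x * christoffel m i k x).

(* [R(X, Y, Z, W) = g(R(X, Y) W, Z)], so that [R(e1, e2, e1, e2)] is the
   sectional curvature of the plane spanned by orthonormal [e1], [e2] *)
Definition riemann X Y Z W : R :=
  \sum_i \sum_j \sum_k \sum_l X 0 i * Y 0 j * Z 0 k * W 0 l *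
    \sum_m G x k m * riemann_comp m i j l.

Definition ricci X Y : R :=
  \sum_k \sum_l invmx (G x) k l * riemann (delta_mx 0 k) X (delta_mx 0 l) Y.

Definition scalar_curvature : R :=
  \sum_k \sum_l invmx (G x) k l * ricci (delta_mx 0 k) (delta_mx 0 l).

End Curvature.

Section Bivectors.
Context {R : realType}.
Implicit Types (X Y Z W : 'rV[R]_4) (M : 'M[R]_(3 + 3)).

(* The bivectors of a Euclidean 4-space with orthonormal basis e0, .., e3 are
   written in the orthonormal basis
   e0^e1, e0^e2, e0^e3, e2^e3, e3^e1, e1^e2. *)
Definition bivector_idx (a : 'I_(3 + 3)) : 'I_4 * 'I_4 :=
  match fintype.split a with
  | inl k => (ord0, lift ord0 k)
  | inr k => (lift ord0 (ordS k), lift ord0 (ordS (ordS k)))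
  end.

Definition wedge X Y : 'rV[R]_(3 + 3) :=
  \row_a (X 0 (bivector_idx a).1 * Y 0 (bivector_idx a).2
          - X 0 (bivector_idx a).2 * Y 0 (bivector_idx a).1).

Definition bivector_dot (u v : 'rV[R]_(3 + 3)) : R := (u *m v^T) 0 0.

(* Operators on bivectors act on row vectors from the right, so that
   [M a b] is the inner product of the image of the [a]-th basis vector with
   the [b]-th one. *)
Definition hodge_star : 'M[R]_(3 + 3) := block_mx 0 1%:M 1%:M 0.

(* [<*(X ^ Y), Z ^ W> = vol(X, Y, Z, W)], which characterizes the Hodge star. *)
Lemma hodge_starE X Y Z W :
  bivector_dot (wedge X Y *m hodge_star) (wedge Z W)
  = \det (\matrix_(i < 4) nth 0 [:: X; Y; Z; W] i).
Proof.
pose x k := X 0 (inord k); pose y k := Y 0 (inord k).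
pose z k := Z 0 (inord k); pose w k := W 0 (inord k).
have -> : (\matrix_(i < 4) nth 0 [:: X; Y; Z; W] i) =
   \matrix_(i < 4, j < 4) nth 0 [:: x j; y j; z j; w j] i.
  by apply/matrixP => -[[|[|[|[|//]]]] lt_i] j; rewrite !mxE /x /y /z /w inord_val.
pose v (a b : nat -> R) : 'rV[R]_(3+3) := \row_i
   nth 0 [:: a 0%N * b 1%N - a 1%N * b 0%N; a 0%N * b 2%N - a 2%N * b 0%N;
     a 0%N * b 3%N - a 3%N * b 0%N; a 2%N * b 3%N - a 3%N * b 2%N;
     a 3%N * b 1%N - a 1%N * b 3%N; a 1%N * b 2%N - a 2%N * b 1%N] i.
have wE A B : wedge A B = v (fun k => A 0 (inord k)) (fun k => B 0 (inord k)).
  apply/rowP => -[[|[|[|[|[|[|//]]]]]] lt_a]; rewrite !mxE /bivector_idx /=;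
  case: splitP => -[[|[|[|//]]] lt_b] /= /eqP //= _;
  by congr (A _ _ * B _ _ - A _ _ * B _ _); apply/val_inj; rewrite /= inordK.
rewrite !wE -/x -/y -/z -/w /bivector_dot -[v x y]hsubmxK mul_row_block.
rewrite !mulmx0 add0r addr0 !mulmx1 -[v z w]hsubmxK tr_row_mx mul_row_col.
have det2 (A : nat -> nat -> R) :
    \det (\matrix_(i < 2, j < 2) A i j)
    = A 0%N 0%N * A 1%N 1%N - A 0%N 1%N * A 1%N 0%N.
  rewrite (expand_det_row _ ord0) !big_ord_recl big_ord0 /cofactor !det_mx11 !mxE.
  by rewrite /= /bump /=; ring.
have det3 (A : nat -> nat -> R) : \det (\matrix_(i < 3, j < 3) A i j)
    = \sum_(j < 3) A 0%N j * ((-1) ^+ j *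
       (A 1%N (bump j 0) * A 2%N (bump j 1) - A 1%N (bump j 1) * A 2%N (bump j 0))).
  rewrite (expand_det_row _ ord0); apply: eq_bigr => j _.
  rewrite mxE /cofactor add0n.
  rewrite -(det2 (fun k l => A k.+1 (bump j l))); congr (_ * (_ * \det _)).
  apply/matrixP => k l; rewrite !mxE /=.
  by case: k => -[|[|//]] /=; case: l => -[|[|//]].
have det4 (A : nat -> nat -> R) : \det (\matrix_(i < 4, j < 4) A i j)
    = \sum_(j < 4) A 0%N j * ((-1) ^+ j *
       \det (\matrix_(k < 3, l < 3) A k.+1 (bump j l))).
  rewrite (expand_det_row _ ord0); apply: eq_bigr => j _.
  rewrite mxE /cofactor add0n; congr (_ * (_ * \det _)).
  by apply/matrixP => k l; rewrite !mxE.
rewrite (det4 (fun i j => nth 0 [:: x j; y j; z j; w j] i)).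
under eq_bigr => j _ do rewrite
  (det3 (fun k l => nth 0 [:: x (bump j l); y (bump j l); z (bump j l);
                              w (bump j l)] k.+1)).
rewrite mxE [X in X + _ = _]mxE [X in _ + X = _]mxE !big_ord_recl !big_ord0 !mxE /= /bump /=.
rewrite !(add0n, addn0, add1n) /=.
ring.
Qed.

(* For [s = 1] (resp. [s = -1]) the rows form an orthonormal basis of the space
   of self-dual (resp. anti-self-dual) bivectors. *)
Definition dual_basis (s : R) : 'M[R]_(3, 3 + 3) :=
  (Num.sqrt 2)^-1 *: row_mx 1%:M s%:M.

Lemma dual_basis_orthonormal s : s ^+ 2 = 1 ->
  dual_basis s *m (dual_basis s)^T = 1%:M.
Proof.
move=> s1; rewrite /dual_basis [in X in _ *m X]linearZ /= -scalemxAl -scalemxAr.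
rewrite scalerA tr_row_mx mul_row_col !tr_scalar_mx mulmx1 -scalar_mxM -(expr2 s) s1.
rewrite -raddfD /= scale_scalar_mx -expr2 exprVn sqr_sqrtr ?ler0n//.
by rewrite mulVf ?pnatr_eq0.
Qed.

Lemma dual_basis_eigenspace s : s ^+ 2 = 1 ->
  (dual_basis s :=: eigenspace hodge_star s)%MS.
Proof.
move=> s1; have s2 : (Num.sqrt 2 : R)^-1 != 0.
  by rewrite invr_eq0 sqrtr_eq0 -ltNge ltr0n.
apply/eqmxP/andP; split.
  apply/eigenspaceP; rewrite /dual_basis /hodge_star -scalemxAl mul_row_block.
  rewrite !mulmx0 add0r addr0 !mulmx1 scalerA mulrC -scalerA.
  by rewrite !scale_row_mx !scale_scalar_mx -(expr2 s) s1 !mulr1.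
rewrite /dual_basis; apply/row_subP => i.
have := row_sub i (eigenspace hodge_star s).
move: (row i _) => v /eigenspaceP; rewrite -[v]hsubmxK /hodge_star mul_row_block.
rewrite !mulmx0 add0r addr0 !mulmx1 scale_row_mx => /eq_row_mx[e _].
rewrite (eqmx_scale _ s2); apply/submxP; exists (lsubmx v).
by rewrite mul_mx_row mulmx1 mul_mx_scalar e.
Qed.

Definition blockA M := dual_basis 1 *m M *m (dual_basis 1)^T.
Definition blockB M := dual_basis 1 *m M *m (dual_basis (-1))^T.
Definition blockC M := dual_basis (-1) *m M *m (dual_basis (-1))^T.

Definition eigenvalues (A : 'M[R]_3) (a1 a2 a3 : R) : Prop :=
  a1 <= a2 <= a3 /\
  char_poly A = ('X - a1%:P) * ('X - a2%:P) * ('X - a3%:P).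

Definition singular_values (B : 'M[R]_3) (b1 b2 b3 : R) : Prop :=
  [&& 0 <= b1, b1 <= b2 & b2 <= b3] /\
  eigenvalues (B^T *m B) (b1 ^+ 2) (b2 ^+ 2) (b3 ^+ 2).

Definition bianchi M : Prop := forall X Y Z W,
  bivector_dot (wedge X Y *m M) (wedge Z W)
  + bivector_dot (wedge Y Z *m M) (wedge X W)
  + bivector_dot (wedge Z X *m M) (wedge Y W) = 0.

Definition curvature_cone (eta mu : R) : set 'M[R]_(3 + 3) :=
  [set M | [/\ M^T = M, bianchi M &
    exists A1 A2 A3 B1 B2 B3 C1 C2 C3 : R,
      [/\ eigenvalues (blockA M) A1 A2 A3,
          singular_values (blockB M) B1 B2 B3 &
          eigenvalues (blockC M) C1 C2 C3] /\
      [/\ (B2 + B3) ^+ 2 <= eta * (A1 + A2) * (C1 + C2),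
          A2 + A3 <= mu * (A1 + A2) &
          C2 + C3 <= mu * (C1 + C2)]]].

(* The rows of [e] are the vectors of a basis of the tangent space. *)
Definition orthonormal_frame (G : 'rV[R]_4 -> 'M[R]_4) x (e : 'M[R]_4) :=
  forall i j, metric_at G x (row i e) (row j e) = (i == j)%:R.

Definition curvature_operator (G : 'rV[R]_4 -> 'M[R]_4) x (e : 'M[R]_4) :
    'M[R]_(3 + 3) :=
  \matrix_(a, b) riemann G x (row (bivector_idx a).1 e) (row (bivector_idx a).2 e)
                             (row (bivector_idx b).1 e) (row (bivector_idx b).2 e).

End Bivectors.

(* The cone is invariant under changes of orthonormal frame, including those
   reversing the orientation, so neither the frame nor the chart matters. *)
Definition curvature_in_cone (R : realType) (M : smooth_manifold R 4)
    (g : riemannian_metric M) (eta mu : R) : Prop :=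
  forall i p, chart_dom (atlas i) p ->
  exists2 e : 'M[R]_4,
    orthonormal_frame (g i) (chart_map (atlas i) p) e &
    curvature_cone eta mu
      (curvature_operator (g i) (chart_map (atlas i) p) e).

(* Main.v *)
Require Import Defs.
From mathcomp Require Import all_boot all_order all_algebra.
From mathcomp Require Import all_classical all_reals all_analysis.
From mathcomp Require Import ring lra.

(** The estimate takes place at one point, in an orthonormal frame, as linear
    algebra of the curvature operator [M] on bivectors. For a tangent vector [X]
    put [T = \sum_a (e_a ^ X)^T (e_a ^ X)]; then [Ric(X, X) = tr (M T)]. Now [T]
    is [|X|^2] times the orthogonal projection onto the bivectors [Y ^ X], whose
    image under the Hodge star is the orthogonal complement, so
    [T + * T * = |X|^2]. Therefore the two diagonal blocks of [T] in the
    splitting into self-dual and anti-self-dual bivectors are [|X|^2 / 2], and,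
    since [T^2 = |X|^2 T], its mixed block [S] satisfies [S S^T = |X|^4 / 4].
    Hence ([ricci_form_dual])
      [Ric(X, X) = |X|^2 / 2 (tr A + tr C) + 2 tr (B S^T)].
    The scalar curvature is [2 tr M = 2 (tr A + tr C)], and the first Bianchi
    identity says [tr A = tr C] ([bianchi_trace]): the first term is
    [|X|^2 scal / 4] and the block [B] carries the traceless Ricci tensor.

    It remains to bound the second term by [4/3 sqrt eta |X|^2 scal / 4]
    ([ricci_pinching]). By the Cauchy-Schwarz inequality for the trace form its
    square is at most [3 |X|^4 (B1^2 + B2^2 + B3^2)], and ordering the singular
    values gives [3 (B1^2 + B2^2 + B3^2) <= 4 (B2 + B3)^2]. The cone bounds
    [(B2 + B3)^2] by [eta (A1 + A2) (C1 + C2)], in which both factors are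
    nonnegative because [mu > 1] and at most [2/3 tr A = 2/3 tr C = scal / 6].
    Eigenvalues and singular values are thus used only through the traces of [A],
    [C] and [B^T B], and no operator has to be diagonalized.

    Expressing [Ric] through [M], whose entries are indexed by bivectors, requires
    the curvature components to be antisymmetric in each pair of indices. For the
    last pair this is the compatibility of the Levi-Civita connection with the
    metric together with the symmetry of the second derivatives of the metric
    ([lowered_riemann_antir], [derive_comm]). *)

Set Implicit Arguments.
Unset Strict Implicit.
Unset Printing Implicit Defensive.

Import Order.TTheory GRing.Theory Num.Theory.
Import numFieldNormedType.Exports.
Local Open Scope classical_set_scope.
Local Open Scope ring_scope.

(** * Symmetry of second derivatives *)

Section Schwarz.
Context {R : realType} {V : normedModType R}.
Implicit Types (f : V -> R) (u v x : V).

Lemma is_derive_line f u x t : derivable f (t *: u + x) u ->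
  is_derive t 1 (fun s : R => f (s *: u + x)) ('D_u f (t *: u + x)).
Proof.
have E : (fun h : R => h^-1 *: (((fun s : R => f (s *: u + x)) \o shift t) (h *: 1)
             - f (t *: u + x)))
       = (fun h => h^-1 *: ((f \o shift (t *: u + x)) (h *: u) - f (t *: u + x))).
  by apply/funext => h /=; rewrite [_%:A]mulr1 scalerDl addrA.
by move=> df; split; rewrite /derivable /derive E.
Qed.

Lemma mean_value (g dg : R -> R) (h : R) : 0 < h ->
  (forall t, 0 <= t <= h -> is_derive t 1 g (dg t)) ->
  exists2 c, 0 <= c <= h & g h - g 0 = h * dg c.
Proof.
move=> h0 gd.
have gd' t : t \in `[0, h] -> is_derive t 1 g (dg t).
  by rewrite in_itv; exact: gd.
have gc : {within `[0, h], continuous g}.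
  by apply: derivable_within_continuous => t /gd'[].
have goo t : t \in `]0, h[ -> is_derive t 1 g (dg t).
  by move=> th; apply: gd'; exact: subset_itv_oo_cc.
have [c ch ->] := @MVT R g dg 0 h h0 goo gc.
exists c; last by rewrite subr0 mulrC.
by move: ch; rewrite in_itv => /andP[/ltW-> /ltW->].
Qed.

(** Symmetric in [u] and [v], hence a common approximation of both mixed second
    derivatives. *)
Definition second_difference f u v x (h : R) : R :=
  f (h *: u + (h *: v + x)) - f (h *: v + x) - (f (h *: u + x) - f x).

(** Two applications of the mean value theorem, along [u] and then along [v], turn
    the second difference into [h ^+ 2] times a value of the mixed derivative at
    a point of the small parallelogram. *)
Lemma second_difference_cvg f u v x :
  (\forall y \near x, derivable f y u) ->
  (\forall y \near x, derivable ('D_u f) y v) ->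
  {for x, continuous ('D_v ('D_u f))} ->
  second_difference f u v x h / h ^+ 2 @[h --> 0^'+] --> 'D_v ('D_u f) x.
Proof.
move=> dfu dfuv /cvgrPdist_lt c2; apply/cvgrPdist_lt => e e0.
(* One ball on which all hypotheses hold; [inball] keeps the parallelogram in it. *)
have [r /= r0 rP] : exists2 r : R, 0 < r & forall y, ball x r y ->
    [/\ derivable f y u, derivable ('D_u f) y v &
        `|'D_v ('D_u f) x - 'D_v ('D_u f) y| < e].
  have : \forall y \near x, [/\ derivable f y u, derivable ('D_u f) y v &
        `|'D_v ('D_u f) x - 'D_v ('D_u f) y| < e].
    by apply: filterS3 dfu dfuv (c2 e e0) => y; split.
  by move/nbhs_ballP => [r r0 rP]; exists r.
have K0 : 0 < `|u| + `|v| + 1 by rewrite ltr_wpDl// addr_ge0.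
near=> h.
have h0 : 0 < h by near: h; exact: nbhs_right_gt.
have inball s t : 0 <= s <= h -> 0 <= t <= h -> ball x r (s *: u + (t *: v + x)).
  move=> /andP[s0 sh] /andP[t0 th]; rewrite -ball_normE /= distrC.
  rewrite (_ : _ - x = s *: u + t *: v); last by rewrite !addrA addrK.
  rewrite (le_lt_trans (ler_normD _ _))// !normrZ !ger0_norm//.
  apply: (@le_lt_trans _ _ (h * (`|u| + `|v| + 1))); last first.
    rewrite -ltr_pdivlMr//; near: h; apply: nbhs_right_lt.
    by rewrite divr_gt0.
  rewrite mulrDr mulrDr mulr1 -[leLHS]addr0 lerD ?(ltW h0)//.
  by rewrite lerD// ler_wpM2r.
have hh : 0 <= h <= h by rewrite lexx (ltW h0).
have zh : 0 <= (0 : R) <= h by rewrite lexx (ltW h0).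
have zz y : y = 0 *: v + y by rewrite scale0r add0r.
pose g s := f (s *: u + (h *: v + x)) - f (s *: u + x).
pose dg s := 'D_u f (s *: u + (h *: v + x)) - 'D_u f (s *: u + x).
have [c ch E1] : exists2 c, 0 <= c <= h & g h - g 0 = h * dg c.
  apply: (mean_value h0) => t th; apply: is_deriveB; apply: is_derive_line.
    by case: (rP _ (inball t h th hh)) => dfy _ _; exact: dfy.
  by rewrite (zz x); case: (rP _ (inball t 0 th zh)) => dfy _ _; exact: dfy.
pose k s := 'D_u f (s *: v + (c *: u + x)).
pose dk s := 'D_v ('D_u f) (s *: v + (c *: u + x)).
have [d dh E2] : exists2 d, 0 <= d <= h & k h - k 0 = h * dk d.
  apply: (mean_value h0) => t th; apply: is_derive_line.
  by rewrite addrCA; have [] := rP _ (inball c t ch th).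
have -> : second_difference f u v x h = h ^+ 2 * dk d.
  rewrite expr2 -mulrA -E2 /k scale0r add0r addrCA -/(dg c) -E1.
  by rewrite /g /second_difference scale0r !add0r; ring.
rewrite mulrC mulKf; last first.
  by rewrite expf_eq0 /= gt_eqF.
rewrite /dk addrCA.
by have [] := rP _ (inball c d ch dh).
Unshelve. all: by end_near. Qed.

(** Schwarz's theorem for directional derivatives: the second difference divided by
    [h ^+ 2] has both mixed derivatives as its limit. *)
Theorem derive_comm f u v x :
  (\forall y \near x, derivable f y u) ->
  (\forall y \near x, derivable f y v) ->
  (\forall y \near x, derivable ('D_u f) y v) ->
  (\forall y \near x, derivable ('D_v f) y u) ->
  {for x, continuous ('D_v ('D_u f))} ->
  {for x, continuous ('D_u ('D_v f))} ->
  'D_v ('D_u f) x = 'D_u ('D_v f) x.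
Proof.
move=> fu fv fuv fvu cuv cvu.
have l1 := second_difference_cvg fu fuv cuv.
have l2 := second_difference_cvg fv fvu cvu.
have E : second_difference f u v x = second_difference f v u x.
  by apply/funext => h; rewrite /second_difference addrCA; ring.
rewrite E in l1; exact: (cvg_unique _ l1 l2).
Qed.

End Schwarz.

(** * Derivatives of sums, determinants and inverse matrices *)

Section Derivability.
Context {R : realType} {V : normedModType R}.
Variables (x v : V).

Lemma is_derive_bigsum (I : Type) (r : seq I) (F : I -> V -> R) (dF : I -> R) :
  (forall i, is_derive x v (F i) (dF i)) ->
  is_derive x v (fun y => \sum_(i <- r) F i y) (\sum_(i <- r) dF i).
Proof.
move=> dFi; elim: r => [|i r IHr].
  rewrite big_nil (_ : (fun y => _) = cst 0); first exact: is_derive_cst.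
  by apply/funext => y; rewrite big_nil.
rewrite big_cons (_ : (fun y => _) = F i + (fun y => \sum_(i <- r) F i y)).
  exact: is_deriveD.
by apply/funext => y; rewrite big_cons.
Qed.

Lemma derivable_bigsum (I : Type) (r : seq I) (F : I -> V -> R) :
  (forall i, derivable (F i) x v) ->
  derivable (fun y => \sum_(i <- r) F i y) x v.
Proof. by move=> dF; have [] := is_derive_bigsum r (fun i => derivableP (dF i)). Qed.

Lemma derivable_bigprod (I : Type) (r : seq I) (F : I -> V -> R) :
  (forall i, derivable (F i) x v) ->
  derivable (fun y => \prod_(i <- r) F i y) x v.
Proof.
move=> dF; elim: r => [|i r IHr].
  rewrite (_ : (fun y => _) = cst 1); first exact: derivable_cst.
  by apply/funext => y; rewrite big_nil.
rewrite (_ : (fun y => _) = F i * (fun y => \prod_(i <- r) F i y)).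
  exact: (derivableM (dF i) IHr).
by apply/funext => y; rewrite big_cons.
Qed.

Lemma derivable_mulc (c : R) (f : V -> R) :
  derivable f x v -> derivable (fun y => c * f y) x v.
Proof. exact: derivableZ. Qed.

Lemma derivable_det n (A : V -> 'M[R]_n) :
  (forall i j, derivable (fun y => A y i j) x v) ->
  derivable (fun y => \det (A y)) x v.
Proof.
move=> dA; apply: derivable_bigsum => s; apply: derivable_mulc.
exact: derivable_bigprod.
Qed.

Lemma derivable_invmx n (A : V -> 'M[R]_n) :
  (forall i j, derivable (fun y => A y i j) x v) ->
  (\forall y \near x, A y \in unitmx) ->
  forall i j, derivable (fun y => invmx (A y) i j) x v.
Proof.
move=> dA uA i j.
pose B := (fun y => (\det (A y))^-1) * (fun y => (\adj (A y)) i j).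
apply: (@near_eq_derivable _ _ _ B).
  by apply: filterS uA => y uAy; rewrite /invmx uAy [RHS]mxE.
apply: derivableM.
  apply: derivableV; last exact: derivable_det.
  by have := nbhs_singleton uA; rewrite unitmxE unitfE.
rewrite (_ : (fun y => _) =
    (fun y => (-1) ^+ (j + i) * \det (row' j (col' i (A y))))); last first.
  by apply/funext => y; rewrite mxE.
apply/derivable_mulc/derivable_det => k l.
rewrite (_ : (fun y => _) = (fun y => A y (lift j k) (lift i l))) //.
by apply/funext => y; rewrite !mxE.
Qed.

End Derivability.

(** * Antisymmetry of the curvature tensor *)

Section Antisymmetry.
Context {R : realType} {n : nat}.
Variables (G : 'rV[R]_n -> 'M[R]_n) (U : set 'rV[R]_n).
Hypothesis U_open : open U.
Hypothesis G_smooth : forall k l, class_C 2 U (fun z => G z k l).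
Hypothesis G_sym : forall y, U y -> (G y)^T = G y.
Hypothesis G_unit : forall y, U y -> G y \in unitmx.

Lemma near_open x : U x -> \forall y \near x, U y.
Proof. by move=> Ux; exact: open_nbhs_nbhs. Qed.

Lemma gram_derivable k l i y : U y ->
  derivable (fun z => G z k l) y (delta_mx 0 i).
Proof. by have [_ /(_ i)[+ _]] := G_smooth k l; apply. Qed.

Lemma gram_partial_derivable k l i j y : U y ->
  derivable (partial i (fun z => G z k l)) y (delta_mx 0 j).
Proof. by have [_ /(_ i)[_ [_ /(_ j)[+ _]]]] := G_smooth k l; apply. Qed.

Lemma gram_partial_continuous k l i j y : U y ->
  {for y, continuous (partial j (partial i (fun z => G z k l)))}.
Proof. by have [_ /(_ i)[_ [_ /(_ j)[_ [+ _]]]]] := G_smooth k l; apply. Qed.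

Lemma gram_partial_comm k l i j x : U x ->
  partial i (partial j (fun z => G z k l)) x
  = partial j (partial i (fun z => G z k l)) x.
Proof.
move=> Ux; have nU := near_open Ux; apply: derive_comm.
- by apply: filterS nU => y Uy; exact: gram_derivable.
- by apply: filterS nU => y Uy; exact: gram_derivable.
- by apply: filterS nU => y Uy; exact: gram_partial_derivable.
- by apply: filterS nU => y Uy; exact: gram_partial_derivable.
- exact: gram_partial_continuous.
- exact: gram_partial_continuous.
Qed.

Lemma gram_partial_sym k l i y : U y ->
  partial i (fun z => G z k l) y = partial i (fun z => G z l k) y.
Proof.
move=> Uy; apply: near_eq_derive; apply: filterS (near_open Uy) => z Uz.
by rewrite -{1}(G_sym Uz) mxE.
Qed.

(** The Christoffel symbols of the first kind. They are linear in the derivatives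
    of the metric, so that differentiating them does not involve the inverse of
    the metric. *)
Definition christoffel1 k i j y : R :=
  2^-1 * (partial i (fun z => G z j k) y + partial j (fun z => G z i k) y
     - partial k (fun z => G z i j) y).

Lemma lower_christoffel k i j y : U y ->
  \sum_m G y k m * christoffel G m i j y = christoffel1 k i j y.
Proof.
move=> Uy; rewrite /christoffel.
pose a l := partial i (fun z => G z j l) y + partial j (fun z => G z i l) y
     - partial l (fun z => G z i j) y.
transitivity (2^-1 * \sum_l (G y *m invmx (G y)) k l * a l).
  under [in RHS]eq_bigr => l _ do rewrite mxE mulr_suml.
  rewrite exchange_big mulr_sumr /=; apply: eq_bigr => m _.
  rewrite mulrCA mulr_sumr; congr (_ * _); apply: eq_bigr => l _.
  by rewrite mulrA.
rewrite mulmxV ?G_unit// (bigD1 k)//= big1 ?addr0 => [|l lk].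
  by rewrite mxE eqxx mul1r.
by rewrite mxE eq_sym (negPf lk) mul0r.
Qed.

(** Compatibility of the connection with the metric. *)
Lemma christoffel1_metric k l i y : U y ->
  christoffel1 k i l y + christoffel1 l i k y = partial i (fun z => G z k l) y.
Proof.
move=> Uy; rewrite /christoffel1 (gram_partial_sym l k i)//.
by rewrite (gram_partial_sym i k l)// (gram_partial_sym i l k)//; field.
Qed.

Lemma christoffel1_derivable k i j p x : U x ->
  derivable (christoffel1 k i j) x (delta_mx 0 p).
Proof.
move=> Ux; apply: derivable_mulc.
by apply: derivableB; [apply: derivableD|]; exact: gram_partial_derivable.
Qed.

Lemma christoffel_derivable k i j p x : U x ->
  derivable (christoffel G k i j) x (delta_mx 0 p).
Proof.
move=> Ux; apply: derivable_mulc; apply: derivable_bigsum => l.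
apply: derivableM.
  apply: derivable_invmx => [k' l'|]; first exact: gram_derivable.
  by apply: filterS (near_open Ux) => y; exact: G_unit.
by apply: derivableB; [apply: derivableD|]; exact: gram_partial_derivable.
Qed.

Lemma partial_christoffel1 k i j p x : U x ->
  partial p (christoffel1 k i j) x =
  \sum_m (G x k m * partial p (christoffel G m i j) x
          + christoffel G m i j x * partial p (fun z => G z k m) x).
Proof.
move=> Ux.
transitivity (partial p (fun y => \sum_m G y k m * christoffel G m i j y) x).
  apply: near_eq_derive; apply: filterS (near_open Ux) => y Uy.
  by rewrite lower_christoffel.
apply: (@derive_val _ _ _ _ _ _ _ (is_derive_bigsum _ _)) => m.
by apply: is_deriveM; apply: derivableP;
  [exact: gram_derivable|exact: christoffel_derivable].
Qed.

(** The components of the curvature tensor with all indices down, in the order in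
    which they enter [riemann]. *)
Definition lowered_riemann x i j k l : R :=
  \sum_m G x k m * riemann_comp G x m i j l.

Lemma lowered_riemann_antil i j k l x :
  lowered_riemann x j i k l = - lowered_riemann x i j k l.
Proof.
rewrite /lowered_riemann -sumrN; apply: eq_bigr => m _; rewrite -mulrN.
congr (_ * _); rewrite /riemann_comp opprD opprB -sumrN; congr (_ + _).
by apply: eq_bigr => p _; rewrite opprB.
Qed.

(** Moving the metric inside the derivative of [christoffel] produces, by the
    compatibility with the metric, two quadratic terms, one of which cancels the
    quadratic part of [riemann_comp]. What remains makes the dependence on [k] and
    [l] visible. *)
Lemma lowered_riemannE i j k l x : U x ->
  lowered_riemann x i j k l
  = partial i (christoffel1 k j l) x - partial j (christoffel1 k i l) x
    - \sum_m christoffel G m j l x * christoffel1 m i k x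
    + \sum_m christoffel G m i l x * christoffel1 m j k x.
Proof.
move=> Ux; rewrite !partial_christoffel1//.
have E i' j' :
  \sum_m G x k m * \sum_p christoffel G m i' p x * christoffel G p j' l x
  = \sum_m christoffel G m j' l x * christoffel1 k i' m x.
  under eq_bigr => m _ do rewrite mulr_sumr.
  rewrite exchange_big; apply: eq_bigr => p _ /=.
  rewrite -lower_christoffel// mulr_sumr; apply: eq_bigr => m _.
  by rewrite mulrA mulrC.
have D i' j' : \sum_m christoffel G m j' l x * partial i' (fun z => G z k m) x
  = \sum_m christoffel G m j' l x * christoffel1 k i' m x
  + \sum_m christoffel G m j' l x * christoffel1 m i' k x.
  rewrite -big_split /=; apply: eq_bigr => m _.
  by rewrite -mulrDr christoffel1_metric.
transitivity (
  \sum_m G x k m * partial i (christoffel G m j l) x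
  - \sum_m G x k m * partial j (christoffel G m i l) x
  + (\sum_m G x k m * \sum_p christoffel G m i p x * christoffel G p j l x
  - \sum_m G x k m * \sum_p christoffel G m j p x * christoffel G p i l x)).
  rewrite -!sumrB -big_split /=; apply: eq_bigr => m _.
  by rewrite /riemann_comp sumrB mulrDr !mulrBr.
have alg (a b c d e f : R) :
  a - b + (c - d) = a + (c + e) - (b + (d + f)) - e + f by ring.
rewrite [in LHS]E [in LHS]E !big_split !D; apply: alg.
Qed.

(** The quadratic terms are exchanged by swapping [k] and [l], and the sum of the
    derivative terms with their swapped versions is a commutator of second
    derivatives of [G]. *)
Lemma lowered_riemann_antir i j k l x : U x ->
  lowered_riemann x i j l k = - lowered_riemann x i j k l.
Proof.
move=> Ux; rewrite !lowered_riemannE//.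
(* Both sides are the pairing by [G] of two vectors of Christoffel symbols. *)
have S i' k' j' l' : \sum_m christoffel G m j' l' x * christoffel1 m i' k' x
    = \sum_m christoffel G m i' k' x * christoffel1 m j' l' x.
  under eq_bigr => m _ do rewrite -lower_christoffel// mulr_sumr.
  rewrite exchange_big; apply: eq_bigr => m _ /=.
  rewrite -lower_christoffel// mulr_sumr; apply: eq_bigr => p _.
  by rewrite mulrCA -{1}(G_sym Ux) mxE; ring.
rewrite (S j k i l) (S i k j l).
have P i' j' : partial i' (christoffel1 l j' k) x + partial i' (christoffel1 k j' l) x
    = partial i' (partial j' (fun z => G z l k)) x.
  rewrite /partial -deriveD; try exact: christoffel1_derivable.
  apply: near_eq_derive; apply: filterS (near_open Ux) => y Uy.
  exact: christoffel1_metric.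
have alg (a b c d s t : R) :
  a + c = b + d -> a - b - s + t = - (c - d - t + s).
  by move=> /(canRL (addrK _)) ->; ring.
have H := gram_partial_comm l k i j Ux; rewrite -(P i j) -(P j i) in H.
exact: (alg _ _ _ _ _ _ H).
Qed.

End Antisymmetry.

(** * Bivectors *)

Section BivectorAlgebra.
Context {R : realType}.
Implicit Types (X Y Z W c d : 'rV[R]_4) (M : 'M[R]_(3 + 3)).

Lemma bivector_idx_lshift (k : 'I_3) :
  bivector_idx (lshift 3 k) = (ord0, lift ord0 k).
Proof. by rewrite /bivector_idx (unsplitK (inl k)). Qed.

Lemma bivector_idx_rshift (k : 'I_3) :
  bivector_idx (rshift 3 k) = (lift ord0 (ordS k), lift ord0 (ordS (ordS k))).
Proof. by rewrite /bivector_idx (unsplitK (inr k)). Qed.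

Lemma sum_ord3 (F : 'I_3 -> R) :
  \sum_k F k = F (inord 0) + F (inord 1) + F (inord 2).
Proof.
rewrite !big_ord_recl big_ord0 addr0 addrA.
by congr (F _ + F _ + F _); apply/val_inj; rewrite /= inordK.
Qed.

Lemma sum_ord4 (F : 'I_4 -> R) :
  \sum_k F k = F (inord 0) + F (inord 1) + F (inord 2) + F (inord 3).
Proof.
rewrite !big_ord_recl big_ord0 addr0 !addrA.
by congr (F _ + F _ + F _ + F _); apply/val_inj; rewrite /= inordK.
Qed.

Lemma sum_bivector_idx (F : 'I_4 -> 'I_4 -> R) :
  \sum_a F (bivector_idx a).1 (bivector_idx a).2 =
  F (inord 0) (inord 1) + F (inord 0) (inord 2) + F (inord 0) (inord 3)
  + (F (inord 2) (inord 3) + F (inord 3) (inord 1) + F (inord 1) (inord 2)).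
Proof.
rewrite big_split_ord /= !sum_ord3 !bivector_idx_lshift !bivector_idx_rshift /=.
by congr (F _ _ + F _ _ + F _ _ + (F _ _ + F _ _ + F _ _));
  apply/val_inj; rewrite /= ?inordK.
Qed.

(** The universal property of bivectors: an alternating bilinear form factors
    through [wedge]. *)
Lemma sum_bivector X Y (r : 'I_4 -> 'I_4 -> R) :
  (forall a b, r b a = - r a b) ->
  \sum_a \sum_b X 0 a * Y 0 b * r a b
  = \sum_a wedge X Y 0 a * r (bivector_idx a).1 (bivector_idx a).2.
Proof.
move=> rC; have r0 a : r a a = 0.
  by have := rC a a; move: (r a a) => y; lra.
under [RHS]eq_bigr => a _ do rewrite mxE.
rewrite (sum_bivector_idx (fun a b => (X 0 a * Y 0 b - X 0 b * Y 0 a) * r a b)).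
rewrite sum_ord4 !(sum_ord4 (fun b => _ * r _ b)) !r0.
rewrite (rC (inord 0) (inord 1)) (rC (inord 0) (inord 2)) (rC (inord 0) (inord 3)).
rewrite (rC (inord 1) (inord 2)) (rC (inord 3) (inord 1)) (rC (inord 2) (inord 3)).
ring.
Qed.

Lemma wedgeC X Y : wedge Y X = - wedge X Y.
Proof. by apply/rowP => a; rewrite !mxE opprB mulrC [X in _ - X]mulrC. Qed.

Lemma wedge_same X : wedge X X = 0.
Proof. by apply/rowP => a; rewrite !mxE mulrC subrr. Qed.

(** The second exterior power of [e] (its second compound matrix). *)
Definition wedge_rows e : 'M[R]_(3 + 3) :=
  \matrix_a wedge (row (bivector_idx a).1 e) (row (bivector_idx a).2 e).

(** The matrix of the linear map [X |-> wedge X c]. *)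
Definition wedge_with c : 'M[R]_(4, 3 + 3) :=
  \matrix_a wedge (delta_mx 0 a) c.

Lemma wedge_with_mul X c : X *m wedge_with c = wedge X c.
Proof.
apply/rowP => b; rewrite !mxE.
have E (i : 'I_4) (y : R) : \sum_a X 0 a * ((i == a)%:R * y) = X 0 i * y.
  rewrite (bigD1 i)//= big1 ?addr0 ?eqxx ?mul1r// => a ai.
  by rewrite eq_sym (negPf ai) mul0r mulr0.
by rewrite -!E -sumrB; apply: eq_bigr => a _; rewrite !mxE -mulrBr !eqxx.
Qed.

Lemma wedge_mulmx X Y e : wedge (X *m e) (Y *m e) = wedge X Y *m wedge_rows e.
Proof.
apply/rowP => b; rewrite [RHS]mxE.
under eq_bigr => a _ do rewrite [wedge_rows _ _ _]mxE.
rewrite -(@sum_bivector _ _ (fun i j => wedge (row i e) (row j e) 0 b)); last first.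
  by move=> i j; rewrite wedgeC mxE.
rewrite !mxE !mulr_suml -sumrB; apply: eq_bigr => i _.
rewrite !mulr_sumr -sumrB; apply: eq_bigr => j _.
by rewrite !mxE; ring.
Qed.

Lemma wedge_rows1 : wedge_rows 1%:M = 1%:M.
Proof.
apply/matrixP => a b; rewrite !mxE.
case: (split_ordP a) => k ->; case: (split_ordP b) => l ->;
  rewrite ?bivector_idx_lshift ?bivector_idx_rshift /=;
  rewrite ?eq_lshift ?eq_rshift ?eq_lrshift ?eq_rlshift.
all: by case: k => -[|[|[|//]]] lt_k; case: l => -[|[|[|//]]] lt_l;
  rewrite /eq_op /=; ring.
Qed.

(** Lagrange's identity. *)
Lemma wedge_dot X Y Z W : bivector_dot (wedge X Y) (wedge Z W)
  = (X *m Z^T) 0 0 * (Y *m W^T) 0 0 - (X *m W^T) 0 0 * (Y *m Z^T) 0 0.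
Proof.
rewrite /bivector_dot mxE.
under eq_bigr => a _ do rewrite [_^T _ _]mxE [wedge Z W _ _]mxE.
rewrite -(@sum_bivector _ _ (fun i j => Z 0 i * W 0 j - Z 0 j * W 0 i)); last first.
  by move=> i j; rewrite opprB.
rewrite ![(_ *m _^T) 0 0]mxE !mulr_suml -sumrB; apply: eq_bigr => i _.
rewrite !mulr_sumr -sumrB; apply: eq_bigr => j _.
by rewrite !mxE; ring.
Qed.

Lemma wedge_with_trmx c :
  wedge_with c *m (wedge_with c)^T = ((c *m c^T) 0 0)%:M - c^T *m c.
Proof.
apply/matrixP => a b.
have := wedge_dot (delta_mx 0 a) c (delta_mx 0 b) c; rewrite /bivector_dot.
rewrite -!wedge_with_mul trmx_mul mulmxA -[_ *m _ *m (wedge_with c)^T]mulmxA.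
rewrite trmx_delta -!rowE -!colE => E.
have -> : (wedge_with c *m (wedge_with c)^T) a b =
  col b (row a (wedge_with c *m (wedge_with c)^T)) 0 0 by rewrite !mxE.
rewrite E !mxE big_ord1 !mxE !eqxx /=.
by rewrite andbT mulr_natl mulrC.
Qed.

(** Averaging over an orthonormal basis turns the Ricci form into the scalar
    curvature; each bivector [e_a ^ e_b] is met twice, which explains the [2]. *)
Lemma sum_wedge_with :
  \sum_b (wedge_with (delta_mx 0 b))^T *m wedge_with (delta_mx 0 b) = 2%:M.
Proof.
apply/matrixP => p q; rewrite summxE.
pose X : 'rV[R]_4 := delta_mx 0 (bivector_idx p).1.
pose Y : 'rV[R]_4 := delta_mx 0 (bivector_idx p).2.
pose r a b := wedge (delta_mx 0 a) (delta_mx 0 b) 0 q : R.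
have rC a b : r b a = - r a b by rewrite /r wedgeC mxE.
have r_diag a : r (bivector_idx a).1 (bivector_idx a).2 = (a == q)%:R.
  have /matrixP/(_ a q) := wedge_rows1.
  by rewrite [X in X = _]mxE !rowE !mulmx1 /r => ->; rewrite mxE.
transitivity (\sum_a \sum_b X 0 a * Y 0 b * r a b
              - \sum_a \sum_b X 0 b * Y 0 a * r a b).
  rewrite exchange_big [X in _ - X]exchange_big -sumrB /=.
  apply: eq_bigr => b _; rewrite -sumrB mxE.
  apply: eq_bigr => a _; rewrite -mulrBl /X /Y /r !mxE !eqxx /=.
  by rewrite ![_ == (bivector_idx p).1]eq_sym ![_ == (bivector_idx p).2]eq_sym; ring.
rewrite [X in _ - X]exchange_big /=.
under [X in _ - X]eq_bigr => a _ do under eq_bigr => b _ do rewrite rC mulrN.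
under [X in _ - X]eq_bigr => a _ do rewrite sumrN.
rewrite sumrN opprK sum_bivector// (bigD1 q)//= big1 ?addr0 => [|a aq]; last first.
  by rewrite r_diag (negPf aq) mulr0.
rewrite r_diag eqxx mulr1 -[wedge X Y 0 q]/(r _ _) r_diag !mxE.
by case: (p == q); rewrite ?mulr1n ?mulr0n; ring.
Qed.

(** [T] is [|c|^2] times the projection onto the bivectors divisible by [c], and
    the Hodge star exchanges these with the bivectors of the orthogonal complement
    of [c]. *)
Lemma wedge_with_hodge c : let T := (wedge_with c)^T *m wedge_with c in
  T + hodge_star *m T *m hodge_star = ((c *m c^T) 0 0)%:M.
Proof.
move=> T; pose x k := c 0 (inord k).
have cE i : c 0 i = x i by rewrite /x inord_val.
have kron (i j : 'I_4) : \sum_(a < 4) (i == a)%:R * (j == a)%:R = (i == j)%:R :> R.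
  rewrite (bigD1 i)//= big1 ?addr0 ?eqxx ?mul1r 1?eq_sym// => a ai.
  by rewrite eq_sym (negPf ai) mul0r.
have TE p q : T p q =
  let: (p1, p2) := bivector_idx p in let: (q1, q2) := bivector_idx q in
  (p1 == q1)%:R * (x p2 * x q2) - (p1 == q2)%:R * (x p2 * x q1)
  - (p2 == q1)%:R * (x p1 * x q2) + (p2 == q2)%:R * (x p1 * x q1).
  rewrite mxE; case Ep: (bivector_idx p) => [p1 p2].
  case Eq: (bivector_idx q) => [q1 q2].
  rewrite -!kron !mulr_suml -!sumrB -big_split; apply: eq_bigr => a _ /=.
  by rewrite !mxE Ep Eq !eqxx /= !cE; ring.
clearbody T.
have -> : (c *m c^T) 0 0 = x 0%N ^+ 2 + x 1%N ^+ 2 + x 2%N ^+ 2 + x 3%N ^+ 2.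
  by rewrite mxE sum_ord4 !mxE !cE !inordK// !expr2.
rewrite -[T in LHS]submxK /hodge_star !mulmx_block.
rewrite !(mul0mx, mulmx0, mul1mx, mulmx1, add0r, addr0).
rewrite add_block_mx (scalar_mx_block 3 3).
congr block_mx; apply/matrixP => k l; rewrite !mxE !TE;
  rewrite ?bivector_idx_lshift ?bivector_idx_rshift;
  case: k => -[|[|[|//]]] lt_k; case: l => -[|[|[|//]]] lt_l;
  rewrite /eq_op /= ?mulr1n ?mulr0n; ring.
Qed.

End BivectorAlgebra.

(** * Curvature in an orthonormal frame *)

Section Frame.
Context {R : realType}.
Variables (G : 'rV[R]_4 -> 'M[R]_4) (x : 'rV[R]_4) (e : 'M[R]_4).
Hypothesis lowered_antir : forall i j k l,
  lowered_riemann G x i j l k = - lowered_riemann G x i j k l.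
Hypothesis e_orthonormal : orthonormal_frame G x e.

(** The curvature as a bilinear form on bivectors in the coordinate basis, which
    need not be orthonormal. *)
Definition coordinate_operator : 'M[R]_(3 + 3) :=
  \matrix_(a, b) lowered_riemann G x (bivector_idx a).1 (bivector_idx a).2
                                     (bivector_idx b).1 (bivector_idx b).2.

Lemma riemannE X Y Z W : riemann G x X Y Z W
  = bivector_dot (wedge X Y *m coordinate_operator) (wedge Z W).
Proof.
have KE a : (coordinate_operator *m (wedge Z W)^T) a 0
    = \sum_k \sum_l Z 0 k * W 0 l *
        lowered_riemann G x (bivector_idx a).1 (bivector_idx a).2 k l.
  rewrite sum_bivector; last by move=> k l; exact: lowered_antir.
  rewrite mxE; apply: eq_bigr => b _; rewrite mulrC.
  by rewrite [_^T _ _]mxE [coordinate_operator _ _]mxE.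
rewrite /bivector_dot -mulmxA mxE.
under eq_bigr => a _ do rewrite KE.
rewrite -(@sum_bivector _ _ _ (fun i j => \sum_k \sum_l Z 0 k * W 0 l *
  lowered_riemann G x i j k l)); last first.
  move=> i j; rewrite -sumrN; apply: eq_bigr => k _.
  rewrite -sumrN; apply: eq_bigr => l _.
  by rewrite lowered_riemann_antil mulrN.
apply: eq_bigr => i _; apply: eq_bigr => j _; rewrite mulr_sumr.
apply: eq_bigr => k _; rewrite mulr_sumr; apply: eq_bigr => l _.
by rewrite !mulrA.
Qed.

Lemma curvature_operatorE : curvature_operator G x e
  = wedge_rows e *m coordinate_operator *m (wedge_rows e)^T.
Proof.
apply/matrixP => a b; rewrite mxE riemannE /bivector_dot.
have E p : wedge (row (bivector_idx p).1 e) (row (bivector_idx p).2 e)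
    = row p (wedge_rows e) by apply/rowP => q; rewrite !mxE.
by rewrite !E -mulmxA -row_mul mulmxA tr_row !mxE; apply: eq_bigr => q _; rewrite !mxE.
Qed.

Lemma gram_orthonormal : e *m G x *m e^T = 1%:M.
Proof.
apply/matrixP => a b; have := e_orthonormal a b.
rewrite /metric_at -row_mul tr_row => E; rewrite [RHS]mxE -E !mxE.
by apply: eq_bigr => j _; rewrite !mxE.
Qed.

Lemma invmx_gram : invmx (G x) = e^T *m e.
Proof.
have E : e^T *m e *m G x = 1%:M.
  by rewrite -mulmxA; apply: mulmx1C; exact: gram_orthonormal.
have [_ Gu] := mulmx1_unit E.
by rewrite -[LHS]mul1mx -E mulmxK.
Qed.

(** Contraction with the inverse metric is a trace over any orthonormal frame. *)
Lemma contract_gram (K : 'M[R]_4) :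
  \sum_k \sum_l invmx (G x) k l *
    ((delta_mx 0 k : 'rV_4) *m K *m (delta_mx 0 l : 'rV_4)^T) 0 0
  = \tr (e *m K *m e^T).
Proof.
rewrite mxtrace_mulC mulmxA -invmx_gram mxtrace_mulC /mxtrace.
have IT : (invmx (G x))^T = invmx (G x).
  by rewrite invmx_gram trmx_mul trmxK.
apply: eq_bigr => k _; rewrite mxE; apply: eq_bigr => l _.
by rewrite trmx_delta -rowE -colE !mxE mulrC -{1}IT mxE.
Qed.

Lemma frame_wedge_with c :
  e *m wedge_with (c *m e) = wedge_with c *m wedge_rows e.
Proof.
by apply/row_matrixP => a; rewrite !rowE !mulmxA !wedge_with_mul wedge_mulmx.
Qed.

Lemma ricci_frame c d : ricci G x (c *m e) (d *m e)
  = \tr (wedge_with c *m curvature_operator G x e *m (wedge_with d)^T).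
Proof.
rewrite curvature_operatorE !mulmxA -frame_wedge_with.
rewrite -[_ *m _ *m (wedge_with d)^T]mulmxA -trmx_mul -frame_wedge_with.
rewrite trmx_mul !mulmxA -2!(mulmxA e).
rewrite -contract_gram; apply: eq_bigr => k _; apply: eq_bigr => l _.
by rewrite riemannE /bivector_dot -!wedge_with_mul trmx_mul !mulmxA.
Qed.

Lemma ricci_bilinear : exists Q : 'M[R]_4,
  forall X Y, ricci G x X Y = (X *m Q *m Y^T) 0 0.
Proof.
exists (\sum_k \sum_l invmx (G x) k l *:
  (wedge_with (delta_mx 0 k) *m coordinate_operator
   *m (wedge_with (delta_mx 0 l))^T)) => X Y.
rewrite mulmx_sumr mulmx_suml summxE; apply: eq_bigr => k _.
rewrite mulmx_sumr mulmx_suml summxE; apply: eq_bigr => l _.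
rewrite -scalemxAr -scalemxAl mxE; congr (_ * _).
rewrite !mulmxA wedge_with_mul -[_ *m Y^T]mulmxA -trmx_mul wedge_with_mul.
rewrite riemannE /bivector_dot wedgeC [wedge (delta_mx 0 l) _]wedgeC.
by rewrite !mulNmx linearN mulmxN opprK.
Qed.

Lemma scalar_curvature_frame :
  scalar_curvature G x = 2 * \tr (curvature_operator G x e).
Proof.
have [Q QE] := ricci_bilinear; rewrite /scalar_curvature.
under eq_bigr => k _ do under eq_bigr => l _ do rewrite QE.
rewrite contract_gram /mxtrace.
transitivity (\sum_b ricci G x (delta_mx 0 b *m e) (delta_mx 0 b *m e)).
  apply: eq_bigr => b _; rewrite QE trmx_mul trmx_delta !mulmxA -colE -!mulmxA -rowE.
  by rewrite [RHS]mxE [RHS]mxE.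
under eq_bigr => b _ do rewrite ricci_frame -mulmxA mxtrace_mulC -mulmxA.
rewrite -raddf_sum -mulmx_sumr sum_wedge_with mul_mx_scalar.
exact: mxtraceZ.
Qed.

Lemma metric_frame c : metric_at G x (c *m e) (c *m e) = (c *m c^T) 0 0.
Proof.
rewrite /metric_at trmx_mul !mulmxA -[_ *m e *m _]mulmxA.
by rewrite -[_ *m _ *m e^T]mulmxA gram_orthonormal mulmx1.
Qed.

End Frame.

(** * Eigenvalues and traces *)

Section Traces.
Context {R : realType}.

Lemma posdef_unitmx n (A : 'M[R]_n) :
  (forall X : 'rV[R]_n, X != 0 -> 0 < (X *m A *m X^T) 0 0) -> A \in unitmx.
Proof.
move=> Apos; rewrite unitmxE unitfE; apply/det0P => -[v v0 vA].
by have := Apos v v0; rewrite vA mul0mx mxE ltxx.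
Qed.

Lemma eigenvalues_trace (A : 'M[R]_3) a1 a2 a3 :
  eigenvalues A a1 a2 a3 -> \tr A = a1 + a2 + a3.
Proof.
move=> [_ charA]; apply: oppr_inj.
rewrite -char_poly_trace// charA.
have -> : ('X - a1%:P) * ('X - a2%:P) * ('X - a3%:P)
    = \prod_(a <- [:: a1; a2; a3]) ('X - a%:P).
  by rewrite !big_cons big_nil mulr1 mulrA.
by rewrite (@coefPn_prod_XsubC _ [:: a1; a2; a3])// !big_cons big_nil addr0 addrA.
Qed.

(** With [A] and [B^T] as vectors of the Euclidean space of matrices. *)
Lemma trace_cauchy_schwarz m n (A : 'M[R]_(m, n)) (B : 'M[R]_(n, m)) :
  \tr (A *m B) ^+ 2 <= \tr (A^T *m A) * \tr (B^T *m B).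
Proof.
have sq_ge0 m' n' (C : 'M[R]_(m', n')) : 0 <= \tr (C^T *m C).
  apply: sumr_ge0 => i _; rewrite mxE; apply: sumr_ge0 => j _.
  by rewrite mxE -expr2 sqr_ge0.
have trBT : \tr (B *m B^T) = \tr (B^T *m B) by exact: mxtrace_mulC.
have trAB : \tr (A^T *m B^T) = \tr (A *m B).
  by rewrite -trmx_mul mxtrace_tr mxtrace_mulC.
have trBA : \tr (B *m A) = \tr (A *m B) by exact: mxtrace_mulC.
(* The squared norm of [u *: A - v *: B^T]. *)
have comb u v : 0 <= u ^+ 2 * \tr (A^T *m A) - 2 * u * v * \tr (A *m B)
                     + v ^+ 2 * \tr (B^T *m B).
  suff -> : u ^+ 2 * \tr (A^T *m A) - 2 * u * v * \tr (A *m B)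
      + v ^+ 2 * \tr (B^T *m B) = \tr ((u *: A - v *: B^T)^T *m (u *: A - v *: B^T)).
    exact: sq_ge0.
  rewrite [(_ - _)^T]linearB /= [(u *: A)^T]linearZ [(v *: B^T)^T]linearZ /=.
  rewrite trmxK mulmxBl !mulmxBr -!scalemxAl -!scalemxAr.
  rewrite !raddfB /= !mxtraceZ trBT trAB trBA.
  move: (\tr _) (\tr _) (\tr _) => p a b; ring.
have a0 := sq_ge0 _ _ A; have b0 := sq_ge0 _ _ B.
move: a0 b0 comb; move: (\tr (A *m B)) (\tr (A^T *m A)) (\tr (B^T *m B)).
move=> p a b a0 b0 comb; rewrite -subr_ge0.
move: b0; rewrite le_eqVlt => /predU1P[b0|b0]; last first.
  rewrite -(pmulr_rge0 _ b0).
  by rewrite (_ : b * _ = b ^+ 2 * a - 2 * b * p * p + p ^+ 2 * b); [exact: comb|ring].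
move: a0; rewrite le_eqVlt => /predU1P[a0|a0]; last first.
  rewrite -(pmulr_rge0 _ a0).
  by rewrite (_ : a * (_ - _) = p ^+ 2 * a - 2 * p * a * p + a ^+ 2 * b);
    [exact: comb|ring].
have := comb 1 p; rewrite -a0 -b0; nra.
Qed.

End Traces.

(** * The splitting into self-dual and anti-self-dual bivectors *)

Section Pinching.
Context {R : realType}.
Implicit Types (c : 'rV[R]_4) (K L M : 'M[R]_(3 + 3)).

Lemma hodge_dual_basis s : s ^+ 2 = 1 ->
  dual_basis s *m hodge_star = s *: dual_basis s :> 'M[R]_(3, 3 + 3).
Proof.
by move=> s1; apply/eigenspaceP; rewrite dual_basis_eigenspace.
Qed.

Lemma dual_basis_resolution :
  (dual_basis 1)^T *m dual_basis 1 + (dual_basis (-1))^T *m dual_basis (-1)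
  = 1%:M :> 'M[R]_(3 + 3).
Proof.
have s2 : (Num.sqrt 2)^-1 * (Num.sqrt 2)^-1 = 2^-1 :> R.
  by rewrite -invfM -expr2 sqr_sqrtr ?ler0n.
rewrite /dual_basis !linearZ /= -!scalemxAl !scalerA s2 -scalerDr.
rewrite !tr_row_mx !mul_col_mx !mul_mx_row !tr_scalar_mx -!scalar_mxM.
rewrite !mul1r !mulr1 mulrNN mulr1 add_block_mx.
rewrite scale_block_mx (scalar_mx_block 3 3 1).
by congr block_mx; apply/matrixP => i j; rewrite !mxE;
  case: (i == j); rewrite ?mulr1n ?mulr0n; field.
Qed.

Local Notation Dp := (dual_basis 1 : 'M[R]_(3, 3 + 3)).
Local Notation Dm := (dual_basis (-1) : 'M[R]_(3, 3 + 3)).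

Lemma dual_block_mul p q (X : 'M[R]_(p, 6)) (Y : 'M[R]_(6, q)) :
  X *m Y = X *m Dp^T *m (Dp *m Y) + X *m Dm^T *m (Dm *m Y).
Proof.
rewrite -!mulmxA ![_^T *m (_ *m Y)]mulmxA -mulmxDr -mulmxDl.
by rewrite dual_basis_resolution mul1mx.
Qed.

Lemma dual_block_trace (K : 'M[R]_(3 + 3)) :
  \tr K = \tr (blockA K) + \tr (blockC K).
Proof.
rewrite -[K in LHS]mulmx1 dual_block_mul !mulmx1 linearD /=.
by congr (_ + _); rewrite mxtrace_mulC mulmxA.
Qed.

Lemma hodge_star_dual_trmx s : s ^+ 2 = 1 ->
  hodge_star *m (dual_basis s)^T = s *: (dual_basis s)^T :> 'M[R]_(3 + 3, 3).
Proof.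
move=> s1; rewrite -[LHS]trmxK trmx_mul trmxK.
rewrite (_ : hodge_star^T = hodge_star).
  by rewrite hodge_dual_basis// linearZ.
by rewrite /hodge_star tr_block_mx trmx0 trmx1.
Qed.

Lemma bivector_basis a : wedge (delta_mx 0 (bivector_idx a).1)
  (delta_mx 0 (bivector_idx a).2) = delta_mx 0 a :> 'rV[R]_(3 + 3).
Proof.
have := congr1 (row a) (wedge_rows1 : _ = 1%:M :> 'M[R]_(3 + 3)).
by rewrite rowK !rowE !mulmx1.
Qed.

(** Both sides say that [M] is orthogonal to the Hodge star: the difference of the
    traces is the trace of [M *m hodge_star], and for [M] symmetric this is twice
    the cyclic sum of the Bianchi identity on the basis vectors. *)
Lemma bianchi_trace M : M^T = M -> bianchi M -> \tr (blockA M) = \tr (blockC M).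
Proof.
move=> Msym Mbianchi.
have trE : \tr (M *m hodge_star) = \tr (blockA M) - \tr (blockC M).
  rewrite dual_block_trace /blockA /blockC -!mulmxA.
  rewrite !hodge_star_dual_trmx ?sqrrN ?expr1n//.
  by rewrite scale1r scaleN1r !mulmxN linearN.
apply/eqP; rewrite -subr_eq0 -trE; apply/eqP.
have basisE a i j : (bivector_idx a).1 = inord i -> (bivector_idx a).2 = inord j ->
    wedge (delta_mx 0 (inord i)) (delta_mx 0 (inord j))
    = delta_mx 0 a :> 'rV[R]_(3 + 3).
  by move=> <- <-; exact: bivector_basis.
have idxl k : (k < 3)%N -> bivector_idx (lshift 3 (inord k)) = (inord 0, inord k.+1).
  move=> k3; rewrite bivector_idx_lshift; congr (_, _); apply/val_inj.
    by rewrite /= inordK.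
  by rewrite /= !inordK.
have idxr k : (k < 3)%N -> bivector_idx (rshift 3 (inord k)) =
    (inord (k.+1 %% 3).+1, inord ((k.+1 %% 3).+1 %% 3).+1).
  move=> k3; rewrite bivector_idx_rshift.
  by congr (_, _); apply/val_inj; rewrite /= !inordK// ltnS ltn_mod.
pose b k := M (lshift 3 (inord k)) (rshift 3 (inord k)).
have Mdot p q : bivector_dot (delta_mx 0 p *m M) (delta_mx 0 q) = M p q.
  by rewrite /bivector_dot trmx_delta -rowE -colE !mxE.
have := Mbianchi (delta_mx 0 (inord 0)) (delta_mx 0 (inord 1))
                 (delta_mx 0 (inord 2)) (delta_mx 0 (inord 3)).
rewrite (basisE (lshift 3 (inord 0))) ?idxl// (basisE (rshift 3 (inord 0))) ?idxr//.
rewrite (basisE (rshift 3 (inord 2))) ?idxr// (basisE (lshift 3 (inord 2))) ?idxl//.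
rewrite (wedgeC (delta_mx 0 (inord 0))) (wedgeC (delta_mx 0 (inord 3))).
rewrite (basisE (lshift 3 (inord 1))) ?idxl// (basisE (rshift 3 (inord 1))) ?idxr//.
rewrite mulNmx /bivector_dot linearN mulmxN mulNmx opprK -!/(bivector_dot _ _) !Mdot.
rewrite -[in X in _ + X + _]Msym mxE -/(b 0%N) -/(b 1%N) -/(b 2%N) => sum_b.
rewrite -[M]submxK /hodge_star mulmx_block !(mulmx0, mulmx1, add0r, addr0).
rewrite mxtrace_block.
have -> : \tr (dlsubmx M) = \tr (ursubmx M) by rewrite -{1}Msym -trmx_ursub mxtrace_tr.
rewrite /mxtrace sum_ord3 !mxE -/(b 0%N) -/(b 1%N) -/(b 2%N).
move: sum_b; lra.
Qed.

(** The operator [T] for which [Ric(c, c) = tr (M T)]. *)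
Definition ricci_bivector c : 'M[R]_(3 + 3) := (wedge_with c)^T *m wedge_with c.

Lemma ricci_bivector_tr c : (ricci_bivector c)^T = ricci_bivector c.
Proof. by rewrite trmx_mul trmxK. Qed.

(** Up to the factor [|c|^2], [T] is a projection: [wedge_with c] is, up to that
    factor, a partial isometry with kernel spanned by [c]. *)
Lemma ricci_bivector_sqr c :
  ricci_bivector c *m ricci_bivector c = (c *m c^T) 0 0 *: ricci_bivector c.
Proof.
rewrite /ricci_bivector mulmxA -[_ *m wedge_with c *m _]mulmxA wedge_with_trmx.
rewrite mulmxBr mulmxBl mul_mx_scalar -scalemxAl mulmxA.
rewrite -trmx_mul wedge_with_mul wedge_same.
by rewrite trmx0 mul0mx mul0mx subr0.
Qed.

(** Since [* = s] on the image of [dual_basis s], the operators [T] and [* T *] have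
    the same compression to it, and their sum is [|c|^2]. *)
Lemma ricci_bivector_dual c s : s ^+ 2 = 1 ->
  dual_basis s *m ricci_bivector c *m (dual_basis s)^T = ((c *m c^T) 0 0 / 2)%:M.
Proof.
move=> s1; have : dual_basis s *m (ricci_bivector c
    + hodge_star *m ricci_bivector c *m hodge_star) *m (dual_basis s)^T
    = ((c *m c^T) 0 0)%:M.
  rewrite wedge_with_hodge mul_mx_scalar -scalemxAl dual_basis_orthonormal//.
  exact: scalemx1.
rewrite mulmxDr mulmxDl -!mulmxA hodge_star_dual_trmx// !mulmxA hodge_dual_basis//.
rewrite -scalemxAr -!scalemxAl scalerA -expr2 s1 scale1r -mulr2n => E.
apply: (@scalerI _ _ 2); first by rewrite pnatr_eq0.
by rewrite scaler_nat E scale_scalar_mx; congr (_%:M); field.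
Qed.

Lemma blockA_ricci_bivector c :
  blockA (ricci_bivector c) = ((c *m c^T) 0 0 / 2)%:M.
Proof. by rewrite /blockA ricci_bivector_dual ?expr1n. Qed.

Lemma blockC_ricci_bivector c :
  blockC (ricci_bivector c) = ((c *m c^T) 0 0 / 2)%:M.
Proof. by rewrite /blockC ricci_bivector_dual ?sqrrN ?expr1n. Qed.

Lemma blockB_tr K : (blockB K)^T = Dm *m K^T *m Dp^T.
Proof. by rewrite /blockB trmx_mul trmxK trmx_mul mulmxA. Qed.

Lemma blockA_mul K L :
  blockA (K *m L) = blockA K *m blockA L + blockB K *m (blockB L^T)^T.
Proof.
rewrite blockB_tr trmxK /blockA /blockB mulmxA -[_ *m L *m _]mulmxA.
by rewrite dual_block_mul !mulmxA.
Qed.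

Lemma blockC_mul K L :
  blockC (K *m L) = (blockB K^T)^T *m blockB L + blockC K *m blockC L.
Proof.
rewrite blockB_tr trmxK /blockC /blockB mulmxA -[_ *m L *m _]mulmxA.
by rewrite dual_block_mul !mulmxA.
Qed.

(** The self-dual block of [T^2 = |c|^2 T] gives [|c|^4 / 4 + B B^T = |c|^4 / 2]. *)
Lemma blockB_ricci_bivector c : let B := blockB (ricci_bivector c) in
  \tr (B *m B^T) = 3 / 4 * ((c *m c^T) 0 0) ^+ 2.
Proof.
move=> B; have := blockA_mul (ricci_bivector c) (ricci_bivector c).
rewrite ricci_bivector_sqr ricci_bivector_tr blockA_ricci_bivector.
rewrite {1}/blockA -scalemxAr -scalemxAl -/(blockA _) blockA_ricci_bivector.
move=> /(canLR (addKr _)) <-.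
rewrite -scalar_mxM scale_scalar_mx linearD linearN /= !mxtrace_scalar.
by move: ((c *m c^T) 0 0) => y; field.
Qed.

(** The diagonal blocks of [T] being scalar, the Ricci form sees [blockA M] and
    [blockC M] only through their traces. *)
Lemma ricci_form_dual M c : M^T = M ->
  \tr (wedge_with c *m M *m (wedge_with c)^T)
  = (c *m c^T) 0 0 / 2 * (\tr (blockA M) + \tr (blockC M))
    + 2 * \tr (blockB M *m (blockB (ricci_bivector c))^T).
Proof.
move=> Msym; rewrite mxtrace_mulC mulmxA -/(ricci_bivector c) mxtrace_mulC.
rewrite dual_block_trace blockA_mul blockC_mul Msym ricci_bivector_tr.
rewrite blockA_ricci_bivector blockC_ricci_bivector !mul_mx_scalar.
rewrite !linearD !linearZ /=.
rewrite -[\tr ((blockB M)^T *m _)]mxtrace_tr (trmx_mul (blockB M)^T) trmxK.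
rewrite [\tr ((blockB _)^T *m _)]mxtrace_mulC.
move: (\tr _) (\tr _) (\tr _) => p q r; ring.
Qed.

(** The Ricci form differs from its trace part by [2 * p], whose square is compared
    by Cauchy-Schwarz with the squared singular values of [blockB M]. *)
Lemma ricci_pinching eta mu M c :
  0 <= eta -> eta < 9 / 16 -> 1 < mu -> curvature_cone eta mu M ->
  let pinch := (1 - 4 / 3 * Num.sqrt eta) * (2 * \tr M / 4) in
  pinch * (c *m c^T) 0 0 <= \tr (wedge_with c *m M *m (wedge_with c)^T) /\
  0 <= pinch * (c *m c^T) 0 0.
Proof.
move=> eta0 eta1 mu1 [Msym Mbianchi [A1 [A2 [A3 [B1 [B2 [B3 [C1 [C2 [C3]]]]]]]]]].
move=> [[evA [/and3P[b0 b12 b23] evB] evC] [etaB muA muC]] pinch.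
have AC := bianchi_trace Msym Mbianchi.
have trM := dual_block_trace M.
have trA := eigenvalues_trace evA; have trC := eigenvalues_trace evC.
have trB := eigenvalues_trace evB.
have [/andP[a12 a23] _] := evA; have [/andP[c12 c23] _] := evC.
rewrite ricci_form_dual// /pinch.
have N0 : 0 <= (c *m c^T) 0 0.
  by rewrite mxE; apply: sumr_ge0 => i _; rewrite mxE -expr2 sqr_ge0.
have := trace_cauchy_schwarz (blockB M) (blockB (ricci_bivector c))^T.
rewrite trmxK blockB_ricci_bivector trB.
set p := \tr (_ *m _); move: N0; set N := (c *m c^T) 0 0 => N0 cs.
set t := \tr (blockA M) in AC trM trA *.
have s0 : 0 <= Num.sqrt eta by exact: sqrtr_ge0.
have ss : Num.sqrt eta ^+ 2 = eta by rewrite sqr_sqrtr.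
move: s0 ss; set s := Num.sqrt eta => s0 ss.
have s1 : s < 3 / 4.
  by rewrite -(@ltr_pXn2r _ 2)// ?nnegrE ?divr_ge0 ?ler0n// ss; lra.
(* [A1 + A2 <= A2 + A3 <= mu (A1 + A2)] with [mu > 1], and likewise for [C]. *)
have A0 : 0 <= A1 + A2 by nra.
have C0 : 0 <= C1 + C2 by nra.
have t0 : 0 <= t by lra.
have trM2 : \tr M = 2 * t by lra.
rewrite trM2 -AC.
have dev : `|2 * p| <= 4 / 3 * s * t * N.
  rewrite -(@ler_pXn2r _ 2)// ?nnegrE ?normr_ge0 ?mulr_ge0// ?divr_ge0// ?ler0n//.
  rewrite real_normK ?num_real//.
  have B23 : (B2 + B3) ^+ 2 <= (2 / 3 * s * t) ^+ 2.
    apply: le_trans etaB _; rewrite -ss.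
    have -> : (2 / 3 * s * t) ^+ 2 = s ^+ 2 * (2 / 3 * t) * (2 / 3 * t) by field.
    rewrite -!(mulrA (s ^+ 2)) ler_wpM2l ?sqr_ge0// ler_pM//; lra.
  (* As [B1 <= B2 <= B3], the difference is at least [B3^2 + 8 B2 B3 - 2 B2^2]. *)
  have nucl : 3 * (B1 ^+ 2 + B2 ^+ 2 + B3 ^+ 2) <= 4 * (B2 + B3) ^+ 2 by nra.
  have N2 : 0 <= N ^+ 2 by exact: sqr_ge0.
  have -> : (4 / 3 * s * t * N) ^+ 2 = 4 * (2 / 3 * s * t) ^+ 2 * N ^+ 2 by field.
  apply: (@le_trans _ _ (3 * (B1 ^+ 2 + B2 ^+ 2 + B3 ^+ 2) * N ^+ 2)); first lra.
  by rewrite ler_wpM2r//; lra.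
move: dev; rewrite ler_norml => /andP[dev _].
split; first lra.
rewrite !mulr_ge0//; lra.
Qed.

End Pinching.

(** * The theorem *)

Theorem lemma5p1 (R : realType) (M : smooth_manifold R 4)
    (g : riemannian_metric M) (eta mu : R)
    (eta_ge0 : 0 <= eta) (eta_lt : eta < 9 / 16)
    (mu_ge : eta + 1 <= mu) (mu_gt1 : 1 < mu)
    (RmC : curvature_in_cone g eta mu) :
  forall (i : atlas_index M) (p : M), chart_dom (atlas i) p ->
  forall X : 'rV[R]_4,
    let x := chart_map (atlas i) p in
    let pinch := (1 - 4 / 3 * Num.sqrt eta) * (scalar_curvature (g i) x / 4) in
    pinch * metric_at (g i) x X X <= ricci (g i) x X X /\
    0 <= pinch * metric_at (g i) x X X.
Proof.
move=> i p ip X x pinch.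
pose U := chart_map (atlas i) @` chart_dom (atlas i).
have Ux : U x by exists p.
have G_sym y : U y -> (g i y)^T = g i y by move=> [q iq <-]; exact: gram_sym.
have G_unit y : U y -> g i y \in unitmx.
  by move=> [q iq <-]; apply: posdef_unitmx => Y; exact: gram_pos.
have antir j k l m := lowered_riemann_antir (@chart_img_open _ _ _ (atlas i))
  (fun k l => gram_smooth g i k l 2%N) G_sym G_unit j k l m Ux.
have [e e_on cone] := RmC i p ip.
have e_unit : e \in unitmx.
  by have [] := mulmx1_unit (etrans (mulmxA _ _ _) (gram_orthonormal e_on)).
rewrite -(mulmxKV e_unit X) (metric_frame e_on) (ricci_frame antir e_on).
rewrite /pinch (scalar_curvature_frame antir e_on).
exact: (ricci_pinching _ eta_ge0 eta_lt mu_gt1 cone).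
Qed.
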